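(* Let $n>1$ be an integer, $\mathbb{F}=\{1,-1\}$, and let $m$ be the positive integer with $n=2m$ or $n=2m+1$. Let $A\in M_n(\mathbb{F})$ be the matrix whose $(i,j)$-th element, for $i,j\in\{0,1,\ldots,n-1\}$, is $$A_{i,j}=\begin{cases}1, & \text{if } n=2m \text{ and } \left\lfloor \tfrac{i(j+1)}{2}\right\rfloor\equiv t \pmod n \text{ for some } t\in\{0,1,\ldots,m-1\},\\ 1, & \text{if } n=2m+1,\ i(j+1)\equiv 1 \pmod 2, \text{ and } \left\lfloor \tfrac{i(j+1)}{2}\right\rfloor\equiv t \pmod n \text{ for some } t\in\{0,1,\ldots,m-1\},\\ 1, & \text{if } n=2m+1,\ i(j+1)\equiv 0 \pmod 2, \text{ and } \left\lfloor \tfrac{i(j+1)}{2}\right\rfloor\equiv t' \pmod n \text{ for some } t'\in\{0,1,\ldots,m\},\\ -1, & \text{otherwise}.\end{cases}$$ Then $A$ is sequency-ordered.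
   Context: $M_n(\mathbb{F})$ is the set of $n\times n$ matrices with entries in $\mathbb{F}=\{1,-1\}$; rows and columns are indexed $0,1,\ldots,n-1$. The sequency of $v=[v_0\ v_1\ \cdots\ v_{n-1}]^T\in\mathbb{F}^n$ is $\mathcal{S}_v=\frac12\sum_{k=0}^{n-2}|v_k-v_{k+1}|$ (the number of sign changes). For $A\in M_n(\mathbb{F})$, $\mathcal{S}_j$ denotes the sequency of its $j$-th column, and $A$ is sequency-ordered if $\mathcal{S}_j=j$ for all $j\in\{0,1,\ldots,n-1\}$. *)

(* Defs.v *)
From HB Require Import structures.
From mathcomp Require Import all_boot all_order all_algebra.
Set Implicit Arguments.
Unset Strict Implicit.
Unset Printing Implicit Defensive.
Import Order.TTheory GRing.Theory Num.Theory.
Local Open Scope ring_scope.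

(* The two-element alphabet {1, -1}, as a subtype of rat so that the half-sum
   of absolute differences in [sequency] can be written directly. *)
Definition F : Type := {x : rat | (x == 1) || (x == -1)}.

Definition Fp1 : F := exist (fun x : rat => (x == 1) || (x == -1)) 1 isT.
Definition Fm1 : F := exist (fun x : rat => (x == 1) || (x == -1)) (-1) isT.

(* For k in {0, ..., n-2}, the indices k and k+1 in {0, ..., n-1}. *)
Definition ord_this (n : nat) (k : 'I_n.-1) : 'I_n := widen_ord (leq_pred n) k.

Fact ord_next_subproof (n : nat) (k : 'I_n.-1) : (k.+1 < n)%N.
Proof. by case: n k => [|n] [k]. Qed.

Definition ord_next (n : nat) (k : 'I_n.-1) : 'I_n :=
  Ordinal (ord_next_subproof k).

Definition sequency (n : nat) (v : 'cV[F]_n) : rat :=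
  2^-1 * \sum_(k < n.-1) `|val (v (ord_this k) 0) - val (v (ord_next k) 0)|.

Definition sequency_ordered (n : nat) (A : 'M[F]_n) : Prop :=
  forall j : 'I_n, sequency (col j A) = (j : nat)%:R.

(* i(j+1) is taken in nat, so %/ 2 is the floor. *)
Definition entry_is_one (n m i j : nat) : bool :=
  [|| (n == 2 * m)%N &&
        [exists t : 'I_m, (i * (j + 1)) %/ 2 == t %[mod n]],
      [&& (n == 2 * m + 1)%N, i * (j + 1) == 1 %[mod 2] &
        [exists t : 'I_m, (i * (j + 1)) %/ 2 == t %[mod n]]]
    | [&& (n == 2 * m + 1)%N, i * (j + 1) == 0 %[mod 2] &
        [exists t : 'I_m.+1, (i * (j + 1)) %/ 2 == t %[mod n]]]]%N.

Definition seq_matrix (n m : nat) : 'M[F]_n :=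
  \matrix_(i < n, j < n) if entry_is_one n m i j then Fp1 else Fm1.

(* Main.v *)
Require Import Defs.
From HB Require Import structures.
From mathcomp Require Import all_boot all_order all_algebra.
From mathcomp Require Import zify.
Set Implicit Arguments.
Unset Strict Implicit.
Unset Printing Implicit Defensive.
Import Order.TTheory GRing.Theory Num.Theory.
Local Open Scope ring_scope.

(** Put [p = j + 1], so that [1 <= p <= n].  All three cases in the definition
    of the matrix say the same thing: the residue of [i * p] modulo [2 * n] is
    less than [n], that is, [(i * p) %/ n] is even ([entry_is_oneE]).  Column
    [j] is thus the square wave of period [2 * n] sampled at the multiples of
    [p], and it changes sign between two rows exactly when the parity of
    [(i * p) %/ n] changes.

    Since [p <= n], that quotient grows by [0] or [1] at each row, so a change
    of parity is the same as an increment, and the number of sign changes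
    telescopes to the value of the quotient in the last row
    ([sequency_parity]).  This value is [((n - 1) * p) %/ n = p - 1 = j],
    because [(n - 1) * p = (p - 1) * n + (n - p)] with [0 <= n - p < n]. *)

Lemma exists_ord_eqmod (n k x : nat) : (k <= n)%N ->
  [exists t : 'I_k, x == t %[mod n]]%N = (x %% n < k)%N.
Proof.
move=> le_kn; apply/existsP/idP => [[t /eqP ->]|lt_xk].
  by rewrite modn_small // (leq_trans (ltn_ord t)).
by exists (Ordinal lt_xk); rewrite /= modn_mod.
Qed.

(** Write [q] for the quotient of [x] by [n]: the even part of [q] contributes
    a multiple of [n] to [x %/ 2], and only its parity survives modulo [n]. *)
Lemma half_modn (n x : nat) : (0 < n)%N ->
  (x %/ 2 %% n = (odd (x %/ n) * n + x %% n) %/ 2)%N.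
Proof.
move=> n_gt0; have lt_rn := ltn_pmod x n_gt0.
rewrite {1}(divn_eq x n) -{1}(odd_double_half (x %/ n)).
set b := odd _; set h := (_./2); set r := (x %% n)%N in lt_rn *.
have -> : ((b + h.*2) * n + r = (h * n) * 2 + (b * n + r))%N by lia.
rewrite divnMDl // modnMDl modn_small //; case: b; lia.
Qed.

(** The three cases of the definition differ because halving rounds: with
    [y = (i * (j + 1)) %% (2 * n)], the condition [y < n] is [y %/ 2 < m],
    unless [n = 2 * m + 1] and [y] is even, when it is [y %/ 2 <= m]. *)
Lemma entry_is_oneE (n m i j : nat) : (0 < n)%N ->
  n = (2 * m)%N \/ n = (2 * m + 1)%N ->
  entry_is_one n m i j = ~~ odd (i * (j + 1) %/ n).
Proof.
move=> n_gt0 n_def; rewrite /entry_is_one.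
rewrite !exists_ord_eqmod; [|lia..].
rewrite half_modn // !ltn_divLR // !modn2; set x := (i * (j + 1))%N.
have odd_x : odd x = (odd (x %/ n) && odd n) (+) odd (x %% n).
  by rewrite {1}(divn_eq x n) oddD oddM.
have := ltn_pmod x n_gt0; rewrite odd_x.
case: (odd _) (x %% n)%N => [] r lt_rn; case: n_def lt_rn => -> lt_rn /=.
- by rewrite eqxx; lia.
- by rewrite eqxx oddD oddM /=; case: (boolP (odd r)); lia.
- by rewrite eqxx; lia.
- by rewrite eqxx; case: (boolP (odd r)); lia.
Qed.

Lemma parity_dist (R : numDomainType) (a b : nat) :
  (a <= b <= a.+1)%N ->
  `|(-1) ^+ a - (-1) ^+ b| = 2%:R * (b%:R - a%:R) :> R.
Proof.
case/andP=> le_ab le_ba1.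
have [->|->] : b = a \/ b = a.+1 by lia.
  by rewrite !subrr normr0 mulr0.
rewrite exprS mulN1r opprK -mulr2n normrMn normrX normrN1 expr1n.
by rewrite -[a.+1]addn1 natrD addrAC subrr add0r mulr1.
Qed.

(** The sign of a sequence of parities that climbs by unit steps flips exactly
    at the steps that climb, so the sequency is the total height climbed. *)
Lemma sequency_parity (n : nat) (v : 'cV[F]_n.+1) (f : nat -> nat) :
  (forall i : 'I_n.+1, val (v i 0) = (-1) ^+ f i) ->
  (forall k, (f k <= f k.+1 <= (f k).+1)%N) ->
  sequency v = (f n)%:R - (f 0%N)%:R.
Proof.
move=> v_parity f_step; rewrite /sequency.
under eq_bigr => k _ do rewrite !v_parity /= parity_dist //.
rewrite -mulr_sumr mulKf // -(big_mkord xpredT (fun k => (f k.+1)%:R - (f k)%:R)).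
by rewrite telescope_sumr.
Qed.

Theorem theorem2p6 (n m : nat) (hn : (1 < n)%N) (hm : (0 < m)%N)
    (hnm : n = (2 * m)%N \/ n = (2 * m + 1)%N) :
  sequency_ordered (seq_matrix n m).
Proof.
case: n hn hnm => // n hn hnm j; have lt_jn := ltn_ord j.
rewrite (@sequency_parity _ _ (fun i => (i * (j + 1)) %/ n.+1)%N).
- rewrite mul0n div0n subr0; congr (_%:R).
  have -> : (n * (j + 1) = j * n.+1 + (n - j))%N by nia.
  by rewrite divnMDl // divn_small ?addn0 // ltnS leq_subr.
- move=> i; rewrite !mxE entry_is_oneE // -signr_odd.
  by case: (odd _).
- move=> k; rewrite mulSn leq_div2r ?leq_addl //=.
  (* one more row adds j + 1 <= n.+1 to the dividend *)
  have -> : ((k * (j + 1) %/ n.+1).+1 = (n.+1 + k * (j + 1)) %/ n.+1)%N.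
    by rewrite divnDl // divnn.
  by rewrite leq_div2r // leq_add2r addn1.
Qed.
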